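(* Let $\mathbb{Q}(4)=\mathbb{Q}[i]$ be the $4$th cyclotomic field and let $\mathbb{Q}(3)=\mathbb{Q}(e^{2\pi i/3})$ be the $3$rd cyclotomic field. Then there are isomorphisms of abelian groups $$K_0^2(\mathbb{Q}(4))\cong\mathbb{Z},\quad K_0^3(\mathbb{Q}(4))\cong\mathbb{Z}^2,\quad K_0^4(\mathbb{Q}(4))\cong\mathbb{Z}\oplus 2\mathbb{Z},\quad K_0^5(\mathbb{Q}(4))\cong\mathbb{Z}^4.$$ Thus $K_0^4(\mathbb{Q}(4))\not\cong\mathbb{Z}^3\cong K_0^4(\mathbb{Q}(3))$.
   Context: An $n$-potent ($n\ge 2$) in a ring $R$ is an element $e$ with $e^n=e$. For a unital ring $R$, let $M_\infty(R)=\bigcup_k M_k(R)$, the direct limit under $a\mapsto \mathrm{diag}(a,0)$, and let $\mathcal{P}^n_\infty(R)$ be the set of $n$-potents in $M_\infty(R)$. For $e,f\in\mathcal{P}^n_\infty(R)$ write $e\sim f$ if, for $k$ large enough that $e,f\in M_k(R)$, there are $a,b\in M_k(R)$ with $e=ab$ and $f=ba$. Let $\mathcal{V}^n(R)$ be the set of equivalence classes, an abelian monoid under $[e]+[f]=[\mathrm{diag}(e,f)]$ with identity $[0]$. The group $K_0^n(R)$ is the Grothendieck completion of $\mathcal{V}^n(R)$. *)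

(* Defs.v *)
From HB Require Import structures.
From mathcomp Require Import all_boot all_order all_algebra all_field.
From mathcomp Require Import ring boolp.

Set Implicit Arguments.
Unset Strict Implicit.
Unset Printing Implicit Defensive.

Import Order.TTheory GRing.Theory Num.Theory.
Local Open Scope ring_scope.
Local Open Scope quotient_scope.

Definition zmod_iso (G H : zmodType) : Prop :=
  exists f : {additive G -> H}, bijective f.

Section Grothendieck.
Variable M : nmodType.
Implicit Types x y z : M * M.

(* (x.1, x.2) stands for the formal difference x.1 - x.2; the extra summand c
   is needed because M need not be cancellative. *)
Definition groth_rel x y : bool :=
  `[< exists c : M, x.1 + y.2 + c = y.1 + x.2 + c >].

Lemma groth_rel_refl : reflexive groth_rel.
Proof. by move=> x; apply/asboolP; exists 0. Qed.

Lemma groth_rel_sym : symmetric groth_rel.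
Proof.
by move=> x y; apply/asboolP/asboolP=> -[c h]; exists c.
Qed.

Lemma groth_rel_trans : transitive groth_rel.
Proof.
move=> y x z /asboolP[c h] /asboolP[d k]; apply/asboolP.
exists (y.1 + y.2 + c + d).
rewrite !addrA [LHS](ACl ((1*4*5)*(3*2*6)))%AC /= h k.
by rewrite !addrA [LHS](ACl (4*2*1*5*3*6))%AC.
Qed.

Canonical groth_equiv :=
  EquivRel groth_rel groth_rel_refl groth_rel_sym groth_rel_trans.

Definition groth := {eq_quot groth_equiv}.
HB.instance Definition _ := Choice.on groth.
HB.instance Definition _ := Quotient.on groth.
HB.instance Definition _ : EqQuotient _ groth_equiv groth := EqQuotient.on groth.

Definition groth0 : groth := \pi_groth (0, 0).
Definition groth_add (u v : groth) : groth := \pi_groth (repr u + repr v).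
Definition groth_opp (u : groth) : groth := \pi_groth ((repr u).2, (repr u).1).

Lemma groth_piP x y : \pi_groth x = \pi_groth y <->
  exists c : M, x.1 + y.2 + c = y.1 + x.2 + c.
Proof.
by split=> [/eqquotP/asboolP|h]; last by apply/eqquotP/asboolP.
Qed.

Lemma groth_reprP x :
  exists c : M, (repr (\pi_groth x)).1 + x.2 + c = x.1 + (repr (\pi_groth x)).2 + c.
Proof. by apply/groth_piP; rewrite reprK. Qed.

Lemma groth_addE x y : groth_add (\pi_groth x) (\pi_groth y) = \pi_groth (x + y).
Proof.
have [c h] := groth_reprP x; have [d k] := groth_reprP y.
apply/groth_piP; exists (c + d) => /=.
rewrite !addrA [LHS](ACl ((1*3*5)*(2*4*6)))%AC /= h k.
by rewrite !addrA [LHS](ACl (1*4*2*5*3*6))%AC.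
Qed.

Lemma groth_oppE x : groth_opp (\pi_groth x) = \pi_groth (x.2, x.1).
Proof.
have [c h] := groth_reprP x.
apply/groth_piP; exists c => /=.
by rewrite [_ + x.1]addrC -h [x.2 + _]addrC.
Qed.

Lemma groth_addA : associative groth_add.
Proof.
elim/quotW=> x; elim/quotW=> y; elim/quotW=> z.
by rewrite (groth_addE y z) (groth_addE x y) !groth_addE addrA.
Qed.

Lemma groth_addC : commutative groth_add.
Proof.
by elim/quotW=> x; elim/quotW=> y; rewrite (groth_addE x y) (groth_addE y x) addrC.
Qed.

Lemma groth_add0 : left_id groth0 groth_add.
Proof. by elim/quotW=> x; rewrite groth_addE add0r. Qed.

Lemma groth_addN : left_inverse groth0 groth_opp groth_add.
Proof.
elim/quotW=> x; rewrite groth_oppE groth_addE.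
by apply/groth_piP; exists 0; rewrite /= !addr0 add0r addrC.
Qed.

HB.instance Definition _ :=
  GRing.isZmodule.Build groth groth_addA groth_addC groth_add0 groth_addN.

End Grothendieck.

Section Npotents.
Variables (n : nat) (hn : (1 < n)%N) (R : pzRingType).

(* An n-potent of M_oo(R) is represented by an n-potent square matrix of some
   finite size; that A and diag(A, 0) are the same element of M_oo(R) is
   accounted for in npeq, which pads its arguments to a common size. *)
Definition npotent := {A : {k : nat & 'M[R]_k} | tagged A ^+ n == tagged A}.

Definition npsize (e : npotent) : nat := tag (val e).
Definition npmx (e : npotent) : 'M[R]_(npsize e) := tagged (val e).

Definition Npotent k (A : 'M[R]_k) (hA : A ^+ n == A) : npotent :=
  exist _ (Tagged (fun k => 'M[R]_k) A) hA.

(* For k <= N, the rectangular pid_mx k are the inclusion and the projection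
   between sizes k and N, so this is diag(A, 0). *)
Definition mxpad k N (A : 'M[R]_k) : 'M[R]_N :=
  (pid_mx k : 'M_(N, k)) *m A *m (pid_mx k : 'M_(k, N)).

Definition npeq (e f : npotent) : Prop :=
  exists N : nat, [/\ (npsize e <= N)%N, (npsize f <= N)%N &
    exists a b : 'M[R]_N,
      mxpad N (npmx e) = a *m b /\ mxpad N (npmx f) = b *m a].

Lemma npmxX e : npmx e ^+ n = npmx e.
Proof. exact/eqP/(valP e). Qed.

Let hn2 : n = (n - 2).+2.
Proof. by case: n hn => [|[|m]] // _; rewrite subn2. Qed.

Lemma npmxX2 e : npmx e ^+ (n - 2).+2 = npmx e.
Proof. by rewrite -hn2 npmxX. Qed.

Lemma expmxS k (A : 'M[R]_k) m : A ^+ m.+1 = A *m A ^+ m.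
Proof. exact: exprS. Qed.

Lemma expmxSr k (A : 'M[R]_k) m : A ^+ m.+1 = A ^+ m *m A.
Proof. exact: exprSr. Qed.

Lemma expmx_swap k l (a : 'M[R]_(k, l)) (b : 'M[R]_(l, k)) m :
  a *m (b *m a) ^+ m = (a *m b) ^+ m *m a.
Proof.
elim: m => [|m IH]; first by rewrite !expr0 mulmx1 mul1mx.
by rewrite !expmxSr mulmxA IH !mulmxA.
Qed.

Lemma pid_mxK k N : (k <= N)%N ->
  (pid_mx k : 'M[R]_(k, N)) *m (pid_mx k : 'M_(N, k)) = 1%:M.
Proof. by move=> h; rewrite pid_mx_id // pid_mx_1. Qed.

Lemma mxpadX k N (A : 'M[R]_k) m : (k <= N)%N ->
  mxpad N A ^+ m.+1 = mxpad N (A ^+ m.+1).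
Proof.
move=> h; elim: m => [|m IH]; first by rewrite !expr1.
rewrite expmxS IH [in RHS]expmxS /mxpad -!mulmxA; do 2!congr (_ *m _).
by rewrite [LHS]mulmxA pid_mxK // mul1mx.
Qed.

Lemma npeqP e f : npeq e f <->
  exists (a : 'M[R]_(npsize e, npsize f)) (b : 'M[R]_(npsize f, npsize e)),
    npmx e = a *m b /\ npmx f = b *m a.
Proof.
split=> [[N [leN lfN [a [b [he hf]]]]] | [a [b [he hf]]]]; last first.
  have lN := leq_maxl (npsize e) (npsize f).
  have rN := leq_maxr (npsize e) (npsize f).
  exists (maxn (npsize e) (npsize f)); split=> //.
  exists (pid_mx (npsize e) *m a *m pid_mx (npsize f)).
  exists (pid_mx (npsize f) *m b *m pid_mx (npsize e)).
  rewrite /mxpad he hf -!mulmxA; split; do 2!congr (_ *m _).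
    by rewrite [RHS]mulmxA pid_mxK // mul1mx.
  by rewrite [RHS]mulmxA pid_mxK // mul1mx.
pose P : 'M[R]_(npsize e, N) := pid_mx (npsize e).
pose P' : 'M[R]_(N, npsize e) := pid_mx (npsize e).
pose Q : 'M[R]_(npsize f, N) := pid_mx (npsize f).
pose Q' : 'M[R]_(N, npsize f) := pid_mx (npsize f).
have PK : P *m P' = 1%:M by apply: pid_mxK.
have QK : Q *m Q' = 1%:M by apply: pid_mxK.
have e_n m : (a *m b) ^+ m.+1 = mxpad N (npmx e ^+ m.+1) by rewrite -he mxpadX.
have f_n m : (b *m a) ^+ m.+1 = mxpad N (npmx f ^+ m.+1) by rewrite -hf mxpadX.
have QF m : (b *m a) ^+ m.+1 *m Q' *m Q = (b *m a) ^+ m.+1.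
  by rewrite f_n /mxpad -!mulmxA -/Q (mulmxA Q) QK mul1mx.
have PE m : P' *m P *m (a *m b) ^+ m.+1 = (a *m b) ^+ m.+1.
  by rewrite e_n /mxpad !mulmxA -/P -/P' -(mulmxA P') PK mulmx1.
exists (P *m a *m (b *m a) ^+ (n - 2).+1 *m Q'), (Q *m b *m P').
have -> : P *m a *m (b *m a) ^+ (n - 2).+1 *m Q' *m (Q *m b *m P') =
    P *m (a *m ((b *m a) ^+ (n - 2).+1 *m Q' *m Q) *m b) *m P'.
  by rewrite !mulmxA.
have -> : Q *m b *m P' *m (P *m a *m (b *m a) ^+ (n - 2).+1 *m Q') =
    Q *m (b *m (P' *m P *m (a *m (b *m a) ^+ (n - 2).+1))) *m Q'.
  by rewrite !mulmxA.
rewrite QF expmx_swap [P' *m P *m _]mulmxA PE -expmx_swap (mulmxA b) -expmxS.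
rewrite expmx_swap -[_ *m a *m b]mulmxA -expmxSr e_n f_n !npmxX2 /mxpad.
rewrite -/P -/P' -/Q -/Q' !mulmxA PK QK !mul1mx.
by rewrite -!mulmxA PK QK !mulmx1.
Qed.

Lemma npeq_refl e : npeq e e.
Proof.
apply/npeqP; exists (npmx e), (npmx e ^+ (n - 2).+1).
by rewrite -expmxS -expmxSr npmxX2.
Qed.

Lemma npeq_sym e f : npeq e f -> npeq f e.
Proof. by move=> /npeqP[a [b [he hf]]]; apply/npeqP; exists b, a. Qed.

(* If e = ab, f = ba = cd and g = dc, then e = e ^+ n = (ac)(d f^(n-2) b)
   and g = g ^+ n = (d f^(n-2) b)(ac). *)
Lemma npeq_trans e f g : npeq e f -> npeq f g -> npeq e g.
Proof.
move=> /npeqP[a [b [he hf]]] /npeqP[c [d [hf' hg]]]; apply/npeqP.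
exists (a *m c), (d *m npmx f ^+ (n - 2) *m b); split.
  rewrite -[LHS]npmxX2 he -!mulmxA (mulmxA c) -hf' (mulmxA (npmx f)).
  by rewrite -expmxS hf mulmxA expmx_swap -mulmxA -expmxSr.
rewrite -[LHS]npmxX2 hg -!mulmxA (mulmxA b) -hf (mulmxA (_ ^+ _)).
by rewrite -expmxSr hf' mulmxA expmx_swap -mulmxA -expmxSr.
Qed.

Lemma npad_subproof N e : (npsize e <= N)%N ->
  mxpad N (npmx e) ^+ n == mxpad N (npmx e).
Proof. by move=> h; rewrite {1}hn2 mxpadX // npmxX2. Qed.

Definition npad N e (h : (npsize e <= N)%N) : npotent :=
  Npotent (npad_subproof h).

Lemma npeq_npad N e (h : (npsize e <= N)%N) : npeq e (npad h).
Proof.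
apply/npeqP; exists (pid_mx (npsize e)), (pid_mx (npsize e) *m npmx e).
by split; first by rewrite mulmxA pid_mxK // mul1mx.
Qed.

Definition npeqb (e f : npotent) : bool := `[< npeq e f >].

Lemma npeqb_refl : reflexive npeqb.
Proof. by move=> e; apply/asboolP/npeq_refl. Qed.

Lemma npeqb_sym : symmetric npeqb.
Proof. by move=> e f; apply/asboolP/asboolP; apply: npeq_sym. Qed.

Lemma npeqb_trans : transitive npeqb.
Proof.
by move=> f e g /asboolP ef /asboolP fg; apply/asboolP/(npeq_trans ef fg).
Qed.

Canonical npeq_equiv := EquivRel npeqb npeqb_refl npeqb_sym npeqb_trans.

Definition Vn := {eq_quot npeq_equiv}.
HB.instance Definition _ := Choice.on Vn.
HB.instance Definition _ := Quotient.on Vn.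
HB.instance Definition _ : EqQuotient _ npeq_equiv Vn := EqQuotient.on Vn.

Lemma Vn_piP e f : \pi_Vn e = \pi_Vn f <-> npeq e f.
Proof. by split=> [/eqquotP/asboolP|h]; last by apply/eqquotP/asboolP. Qed.

Lemma block_diagX k l (A : 'M[R]_k) (B : 'M[R]_l) m :
  block_mx A 0 0 B ^+ m = block_mx (A ^+ m) 0 0 (B ^+ m).
Proof.
elim: m => [|m IH]; first by rewrite !expr0 -scalar_mx_block.
by rewrite !expmxS IH mulmx_block !mulmx0 !mul0mx !addr0 !add0r.
Qed.

Lemma npdiag_subproof e f :
  block_mx (npmx e) 0 0 (npmx f) ^+ n == block_mx (npmx e) 0 0 (npmx f).
Proof. by rewrite block_diagX !npmxX. Qed.

Definition npdiag (e f : npotent) : npotent := Npotent (npdiag_subproof e f).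

Lemma np0_subproof : (0 : 'M[R]_0) ^+ n == 0.
Proof. by apply/eqP/matrixP => -[]. Qed.

Definition np0 : npotent := Npotent np0_subproof.

Definition Vn_zero : Vn := \pi_Vn np0.
Definition Vn_add (x y : Vn) : Vn := \pi_Vn (npdiag (repr x) (repr y)).

Lemma npeq_diag e e' f f' :
  npeq e e' -> npeq f f' -> npeq (npdiag e f) (npdiag e' f').
Proof.
move=> /npeqP[a [b [he he']]] /npeqP[c [d [hf hf']]]; apply/npeqP.
exists (block_mx a 0 0 c), (block_mx b 0 0 d).
rewrite !mulmx_block !mulmx0 !mul0mx !addr0 !add0r -he -he' -hf -hf'.
by split.
Qed.

Lemma Vn_addE e f : Vn_add (\pi_Vn e) (\pi_Vn f) = \pi_Vn (npdiag e f).
Proof. by apply/Vn_piP/npeq_diag; apply/Vn_piP; rewrite reprK. Qed.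

Lemma npdiagC e f : npeq (npdiag e f) (npdiag f e).
Proof.
apply/npeqP; exists (block_mx 0 (npmx e) (npmx f) 0).
exists (block_mx 0 (npmx f ^+ (n - 2).+1) (npmx e ^+ (n - 2).+1) 0).
rewrite !mulmx_block !mulmx0 !mul0mx !addr0 !add0r -!expmxS -!expmxSr !npmxX2.
by split.
Qed.

Lemma npeq_castmx e f (h : npsize f = npsize e) :
  npmx e = castmx (h, h) (npmx f) -> npeq e f.
Proof.
move=> hm; apply/npeqP.
exists (castmx (h, erefl) (npmx f)).
exists (castmx (erefl, h) (npmx f ^+ (n - 2).+1)).
rewrite hm {hm}; move: (npsize e) h => k h; case: _ / h.
by rewrite !castmx_id -expmxS -expmxSr npmxX2.
Qed.

Lemma npdiagA e f g : npeq (npdiag e (npdiag f g)) (npdiag (npdiag e f) g).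
Proof.
apply: (@npeq_castmx (npdiag e (npdiag f g)) (npdiag (npdiag e f) g)
  (esym (addnA (npsize e) (npsize f) (npsize g)))).
have := @block_mxA R _ _ _ _ _ _ (npmx e) 0 0 0 (npmx f) 0 0 0 (npmx g).
by rewrite !row_mx0 !col_mx0.
Qed.

Lemma npdiag0 e : npeq (npdiag np0 e) e.
Proof.
apply/npeqP; exists (col_mx 0 (npmx e)).
exists (row_mx 0 (npmx e ^+ (n - 2).+1)).
rewrite mul_col_row mul_row_col mul0mx !mulmx0 mul0mx add0r.
by rewrite -expmxS -expmxSr npmxX2.
Qed.

Lemma Vn_addA : associative Vn_add.
Proof.
elim/quotW=> e; elim/quotW=> f; elim/quotW=> g.
rewrite (Vn_addE f g) (Vn_addE e f) (Vn_addE e) (Vn_addE _ g).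
exact/Vn_piP/npdiagA.
Qed.

Lemma Vn_addC : commutative Vn_add.
Proof.
elim/quotW=> e; elim/quotW=> f; rewrite (Vn_addE e f) (Vn_addE f e).
exact/Vn_piP/npdiagC.
Qed.

Lemma Vn_add0 : left_id Vn_zero Vn_add.
Proof.
by elim/quotW=> e; rewrite (Vn_addE np0 e); apply/Vn_piP/npdiag0.
Qed.

HB.instance Definition _ := GRing.isNmodule.Build Vn Vn_addA Vn_addC Vn_add0.

Definition K0 : zmodType := groth Vn.

End Npotents.

Arguments K0 n hn R : clear implicits.

(* The subfield Q(z) of algC; with z a primitive n-th root of unity, the n-th
   cyclotomic field.  subFExtend only needs a nonzero polynomial vanishing at z
   and does not require it to be irreducible. *)
Definition cyclotomic_field (n : nat) (z : algC) : fieldType :=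
  subFExtend (ratr : {rmorphism rat -> algC}) z ('X^n - 1).

(* exp (2 pi i / 3) *)
Definition omega3 : algC := (- 1 + 'i * sqrtC 3) / 2.

Definition Q4 : fieldType := cyclotomic_field 4 'i.
Definition Q3 : fieldType := cyclotomic_field 3 omega3.

Lemma primitive_i : 4.-primitive_root ('i : algC).
Proof.
have [|m hm m4] := @prim_order_exists _ 4 ('i : algC) isT.
  by rewrite (exprM _ 2 2) sqrCi sqrrN expr1n.
have N1 : (-1 : algC) == 1 = false by rewrite -subr_eq0 -opprD oppr_eq0 (pnatr_eq0 _ 2).
have : m \in divisors 4 by rewrite -dvdn_divisors.
rewrite !inE => /or3P[] /eqP em; move: hm; rewrite em // => /prim_expr_order.
  by move/(congr1 (fun x => x ^+ 2)); rewrite expr1 sqrCi expr1n => /eqP; rewrite N1.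
by rewrite sqrCi => /eqP; rewrite N1.
Qed.

Lemma primitive_omega3 : 3.-primitive_root omega3.
Proof.
have h : omega3 ^+ 2 + omega3 + 1 = 0.
  have h3 : sqrtC (3 : algC) ^+ 2 = 3 by rewrite sqrtCK.
  have hi : ('i : algC) ^+ 2 = -1 by exact: sqrCi.
  rewrite /omega3; move: (sqrtC 3) h3 ('i) hi => s h3 j hj.
  by field: h3 hj.
have h1 : omega3 ^+ 3 = 1.
  by apply/eqP; rewrite -subr_eq0 -[X in _ - X](expr1n _ 3) subrXX
    !big_ord_recl big_ord0 /= !expr1n !mulr1 addr0 addrA h mulr0.
have [|m hm m3] := @prim_order_exists _ 3 omega3 isT; first exact: h1.
have : m \in divisors 3 by rewrite -dvdn_divisors.
rewrite !inE => /orP[] /eqP em; move: hm; rewrite em // => /prim_expr_order.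
rewrite expr1 => o1; move: h; rewrite o1 expr1n => /eqP.
by rewrite (_ : 1 + 1 + 1 = 3%:R) ?pnatr_eq0 //; ring.
Qed.

Definition twoZ := {x : int | x \in dvdz 2}.
HB.instance Definition _ := SubChoice.on twoZ.
HB.instance Definition _ := [SubChoice_isSubZmodule of twoZ by <:].

(* Main.v *)
Require Import Defs.
From HB Require Import structures.
From mathcomp Require Import all_boot all_order all_algebra all_field.
From mathcomp Require Import ring lra boolp.
Import GRing.Theory Num.Theory.
Local Open Scope ring_scope.

(** Over a field F of characteristic zero, an n-potent matrix A satisfies
X * (X^(n-1) - 1) = 0, a separable equation, so the row space on which it acts
is semisimple: apart from the kernel of A it is a direct sum of simple modules
F[X]/(p), one kind for each irreducible factor p of X^(n-1) - 1. The relation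
e = ab, f = ba identifies e and f exactly when these invertible parts are
isomorphic, so K_0^n(F) is free with one generator for each such factor; this
is K0_free, and everything else is a count of factors.

Generation (blocks_generate) is by induction on the rank of A. If A is nonzero,
some nonzero vector u is killed by p(A) for one of the factors p, and
u, uA, uA^2, ... span a copy of the companion block of p (krylov_companion,
krylov_free). Averaging a retraction over the powers of A, as in Maschke's
theorem, makes this copy a direct summand, and the complement is an n-potent of
smaller rank (npotent_split).

Independence of the generators is seen by traces. Since tr((ab)^i) = tr((ba)^i)
for i > 0, each polynomial X * q gives a homomorphism K_0^n(F) -> F sending
[e] to tr(e * q(e)). Bezout provides q with X * q congruent to 1 modulo one
factor and to 0 modulo the others (dual_poly); the corresponding homomorphism
sends the block of that factor to its size, nonzero in F, and kills the others.

For Q(4) = Q(i) and n = 2, 3, 5, and for Q(3) and n = 4, the field contains the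
(n-1)-th roots of unity, so there are n - 1 factors (K0_prim_root). For Q(4)
and n = 4 there are only two, X - 1 and X^2 + X + 1, because a root of the
latter in Q(i) would make 3 the square of a rational (Q4_no_cube_root).
Finally Z + 2Z is Z^2, and Z^2 and Z^3 are told apart by extending scalars to
the rationals and comparing ranks (rV_int_iso_dim). *)

Set Implicit Arguments.
Unset Strict Implicit.
Unset Printing Implicit Defensive.

(** * Isomorphisms of abelian groups and the Grothendieck construction *)

Lemma additive_inverse (G H : zmodType) (f : {additive G -> H}) g :
  cancel f g -> cancel g f -> exists h : {additive H -> G}, h =1 g.
Proof.
move=> fK gK.
have gB : {morph g : x y / x - y}.
  by move=> x y; apply: (can_inj fK); rewrite raddfB !gK.
pose hB := GRing.isZmodMorphism.Build H G g gB.
pose h : {additive H -> G} := HB.pack g hB.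
by exists h.
Qed.

Lemma zmod_iso_sym (G H : zmodType) : zmod_iso G H -> zmod_iso H G.
Proof.
move=> [f [g fK gK]]; have [h hg] := additive_inverse fK gK.
by exists h, f => x; rewrite hg.
Qed.

Lemma zmod_iso_trans (G H K : zmodType) :
  zmod_iso G H -> zmod_iso H K -> zmod_iso G K.
Proof. by move=> [f fb] [g gb]; exists (g \o f); apply: bij_comp. Qed.

(** The universal property of the group completion: additive invariants of the
monoid with values in a group extend to it. *)
Section GrothendieckLift.
Variables (M : nmodType) (G : zmodType) (g : {additive M -> G}).

Definition groth_lift (u : groth M) : G := g (repr u).1 - g (repr u).2.

Lemma groth_liftE x : groth_lift (\pi_(groth M)%qT x) = g x.1 - g x.2.
Proof.
have [c /(congr1 g)] := groth_reprP x; rewrite !raddfD => /addIr h.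
by apply/eqP; rewrite subr_eq addrAC eq_sym subr_eq h.
Qed.

Lemma groth_lift_zmod : zmod_morphism groth_lift.
Proof.
elim/quotW=> x; elim/quotW=> y.
rewrite [- _]groth_oppE [_ + _]groth_addE !groth_liftE /= !raddfD /=.
by rewrite opprK addrACA [g y.2 - _]addrC.
Qed.

HB.instance Definition _ :=
  GRing.isZmodMorphism.Build (groth M) G groth_lift groth_lift_zmod.

End GrothendieckLift.

(** * Classes and traces of n-potents *)

Section Classes.
Variables (n : nat) (hn : (1 < n)%N) (R : pzRingType).
Implicit Types e f : npotent n R.

Definition Vclass e : Vn hn R := \pi_(Vn hn R)%qT e.

Lemma Vclass_eq e f : npeq e f -> Vclass e = Vclass f.
Proof. by move=> h; apply/Vn_piP. Qed.

Lemma Vclass_diag e f : Vclass (npdiag e f) = Vclass e + Vclass f.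
Proof. by rewrite /Vclass -(Vn_addE hn). Qed.

Lemma Vclass_surj (x : Vn hn R) : exists e, x = Vclass e.
Proof. by exists (repr x); rewrite /Vclass reprK. Qed.

Definition K0class (x : Vn hn R) : K0 n hn R := \pi_(groth (Vn hn R))%qT (x, 0).

Lemma K0class_nmod : nmod_morphism K0class.
Proof.
split=> // x y; apply: etrans (esym (groth_addE _ _)).
by congr (\pi_(groth _)%qT (_, _)); rewrite /= addr0.
Qed.

HB.instance Definition _ :=
  GRing.isNmodMorphism.Build (Vn hn R) (K0 n hn R) K0class K0class_nmod.

(** With this, surjectivity of a homomorphism into K_0^n need only be checked on
classes of n-potents. *)
Lemma K0class_diff (u : K0 n hn R) :
  exists x y : Vn hn R, u = K0class x - K0class y.
Proof.
elim/quotW: u => -[x y]; exists x, y.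
rewrite /K0class [- _]groth_oppE [RHS]groth_addE.
by congr (\pi_(groth _)%qT (_, _)); rewrite /= ?addr0 ?add0r.
Qed.

End Classes.

Section Traces.
Variables (n : nat) (hn : (1 < n)%N) (F : fieldType).
Implicit Types (e f : npotent n F) (q : {poly F}).

(** This is tr(e * q(e)). It is spelled out as a sum because evaluation of
polynomials at a matrix requires the size to be a successor, whereas an
n-potent may have size 0; the extra factor e is what makes it invariant under
padding by zeros. *)
Definition nptrace q e : F :=
  \sum_(i < size q) q`_i * \tr (npmx e ^+ i.+1).

Lemma nptrace_horner q k (A : 'M[F]_k.+1) (hA : A ^+ n == A) :
  nptrace q (Npotent hA) = \tr (horner_mx A ('X * q)).
Proof.
rewrite rmorphM /= horner_mx_X -[q in RHS]coefK poly_def.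
rewrite raddf_sum /= mulr_sumr raddf_sum; apply: eq_bigr => i _ /=.
by rewrite linearZ rmorphXn /= horner_mx_X -scalerAr -exprS linearZ.
Qed.

(** For i > 0, (ab)^i = a * ((ba)^(i-1) * b), and the trace of a product does not
depend on the order of its two factors. *)
Lemma nptrace_npeq q e f : npeq e f -> nptrace q e = nptrace q f.
Proof.
move=> /(npeqP hn)[a [b [he hf]]]; apply: eq_bigr => i _; congr (_ * _).
rewrite he hf expmxSr mulmxA -expmx_swap [LHS]mxtrace_mulC.
by rewrite mulmxA -expmxS.
Qed.

Lemma nptrace_diag q e f : nptrace q (npdiag e f) = nptrace q e + nptrace q f.
Proof.
rewrite /nptrace -big_split; apply: eq_bigr => i _ /=.
by rewrite -mulrDr -(mxtrace_block _ 0 0) -block_diagX.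
Qed.

Lemma nptrace0 q : nptrace q (np0 n F) = 0.
Proof. by rewrite /nptrace big1 // => i _; rewrite /mxtrace big_ord0 mulr0. Qed.

Definition Vtrace q (x : Vn hn F) : F := nptrace q (repr x).

Lemma VtraceE q e : Vtrace q (Vclass hn e) = nptrace q e.
Proof. by apply: nptrace_npeq; apply/(Vn_piP hn); rewrite reprK. Qed.

Lemma Vtrace_nmod q : nmod_morphism (Vtrace q).
Proof.
split=> [|x y]; first by rewrite [LHS]VtraceE nptrace0.
have [e ->] := Vclass_surj x; have [f ->] := Vclass_surj y.
by rewrite -Vclass_diag !VtraceE nptrace_diag.
Qed.

HB.instance Definition _ q :=
  GRing.isNmodMorphism.Build (Vn hn F) F (Vtrace q) (Vtrace_nmod q).

Definition K0trace q : {additive K0 n hn F -> F} := groth_lift (Vtrace q).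

Lemma K0traceE q e : K0trace q (K0class (Vclass hn e)) = nptrace q e.
Proof. by rewrite /K0trace [LHS]groth_liftE /= VtraceE raddf0 subr0. Qed.

End Traces.

(** * Splitting off a direct summand *)

Section Splitting.
Variables (n : nat) (hn : (1 < n)%N) (F : fieldType).
Hypothesis nF : n.-1%:R != 0 :> F.

Lemma mulmxX_intertwine k d (A : 'M[F]_k) (C : 'M_d) (U : 'M_(d, k)) i :
  U *m A = C *m U -> U *m A ^+ i = C ^+ i *m U.
Proof.
move=> UA; elim: i => [|i IH]; first by rewrite !expr0 mulmx1 mul1mx.
by rewrite expmxS mulmxA UA -mulmxA IH mulmxA -expmxS.
Qed.

(** Maschke's averaging: if V is any right inverse of the embedding U, the mean of
A^i * V * C^(-i) over i = 1, ..., n-1 is still a right inverse and intertwines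
A and C. Here C^(-i) is written C^(n-1-i), and the sum runs over shifted
indices. *)
Lemma equivariant_retraction k d (A : 'M[F]_k) (C : 'M_d) (U : 'M_(d, k)) :
    A ^+ n = A -> C ^+ n.-1 = 1 -> row_free U -> U *m A = C *m U ->
  exists W : 'M_(k, d), U *m W = 1%:M /\ A *m W = W *m C.
Proof.
move=> An Cn Ufree UA; set m := n.-1 in Cn *.
have nE : n = m.+1 by rewrite prednK // ltnW.
have [V UK] : exists V, U *m V = 1%:M by exists (pinvmx U); apply: mulmxVp.
pose T i := A ^+ i.+1 *m V *m C ^+ (m - i).
exists (m%:R^-1 *: \sum_(i < m) A ^+ i.+1 *m V *m C ^+ (m - i.+1)).
split.
  rewrite -scalemxAr mulmx_sumr (eq_bigr (fun _ => 1%:M)) => [|i _].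
    by rewrite sumr_const card_ord -scaler_nat scalerA mulVf // scale1r.
  rewrite !mulmxA (mulmxX_intertwine _ UA) -(mulmxA _ U) UK mulmx1.
  by apply: etrans (esym (exprD C i.+1 (m - i.+1))) _; rewrite subnKC.
rewrite -scalemxAr -scalemxAl; congr (_ *: _).
(* Both products are sums of T over shifted ranges, differing only by
   T m = A^n V and T 0 = A V C^m, which are equal. *)
have -> : A *m (\sum_(i < m) A ^+ i.+1 *m V *m C ^+ (m - i.+1))
    = \sum_(i < m) T i.+1.
  by rewrite mulmx_sumr; apply: eq_bigr => i _; rewrite !mulmxA -expmxS.
have -> : (\sum_(i < m) A ^+ i.+1 *m V *m C ^+ (m - i.+1)) *m C
    = \sum_(i < m) T i.
  rewrite mulmx_suml; apply: eq_bigr => i _.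
  by rewrite -mulmxA -expmxSr -subSn // subSS.
apply: (@addrI _ (T 0%N)); rewrite -[LHS](big_ord_recl m T) big_ord_recr /=.
rewrite addrC; congr (_ + _); rewrite /T subnn subn0 Cn -nE An.
by rewrite expr0 expr1.
Qed.

(** With W an equivariant retraction of U, the projection W * U commutes with A and
cuts out the copy of C; the n-potent f is A on the complementary summand. Its
rank is smaller because the row space of A contains that of U, which meets the
complement trivially. *)
Lemma npotent_split k d (A : 'M[F]_k) (C : 'M_d) (U : 'M_(d, k))
    (hA : A ^+ n == A) (hC : C ^+ n == C) :
    (0 < d)%N -> C ^+ n.-1 = 1 -> row_free U -> U *m A = C *m U ->
  exists f : npotent n F,
    npeq (Npotent hA) (npdiag (Npotent hC) f) /\ (\rank (npmx f) < \rank A)%N.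
Proof.
move=> d0 Cn Ufree UA; have /eqP An := hA.
have [W [UW AW]] := equivariant_retraction An Cn Ufree UA.
(* The projection onto the complement of the image of U. *)
pose Q := 1%:M - W *m U.
have UQ : U *m Q = 0 by rewrite mulmxBr mulmx1 mulmxA UW mul1mx subrr.
have QW : Q *m W = 0 by rewrite mulmxBl mul1mx -mulmxA UW mulmx1 subrr.
have QQ : Q *m Q = Q.
  by rewrite {1}/Q mulmxBl mul1mx -mulmxA UQ mulmx0 subr0.
have AQ : A *m Q = Q *m A.
  by rewrite mulmxBr mulmxBl mulmx1 mul1mx mulmxA AW -!mulmxA UA.
have QX i : A ^+ i *m Q = Q *m A ^+ i by rewrite -(mulmxX_intertwine i (esym AQ)).
have QAX i : (Q *m A) ^+ i.+1 = Q *m A ^+ i.+1.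
  elim: i => [|i IH]; first by rewrite !expr1.
  by rewrite expmxS IH -AQ mulmxA -(mulmxA A) QQ AQ -mulmxA -expmxS.
have nE : n = (n - 2).+2 by case: (n) hn => [|[|j]] // _; rewrite subn2.
have hD : (Q *m A) ^+ n == Q *m A by rewrite {1}nE QAX -nE An.
exists (Npotent hD); split; last first.
  apply: rank_ltmx; rewrite /ltmx submxMl /=; apply/negP=> AD.
  have UA' : (U <= A)%MS.
    apply/submxP; exists (C ^+ (n - 2) *m U).
    have -> : C ^+ (n - 2) *m U *m A = C ^+ n.-1 *m U.
      by rewrite -mulmxA UA mulmxA -expmxSr {2}nE.
    by rewrite Cn mul1mx.
  have [X UX] : exists X, U = X *m (Q *m A).
    by apply/submxP; apply: submx_trans UA' AD.
  have UW0 : U *m W = 0 by rewrite UX -AQ -!mulmxA QW !mulmx0.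
  have U0 : U = 0 by rewrite -[U]mul1mx -UW UW0 mul0mx.
  move: d0; have := Ufree; rewrite /row_free U0 mxrank0 => /eqP <-.
  by rewrite ltnn.
apply/(npeqP hn).
have A_eq : A = W *m (C *m U) + Q *m A *m (Q *m A ^+ (n - 2).+1).
  rewrite -UA -AQ (mulmxA (A *m Q)) -(mulmxA A) QQ AQ -(mulmxA Q A) -expmxS -nE An.
  by rewrite mulmxA mulmxBl mul1mx addrC subrK.
have D_eq : Q *m A ^+ (n - 2).+1 *m (Q *m A) = Q *m A.
  by rewrite mulmxA -(mulmxA Q) QX mulmxA QQ -mulmxA -expmxSr -nE An.
exists (row_mx W (Q *m A)), (col_mx (C *m U) (Q *m A ^+ (n - 2).+1)).
rewrite mul_row_col mul_col_row D_eq -A_eq; split=> //.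
rewrite -mulmxA UW mulmx1 (mulmxA (C *m U)) -(mulmxA C) UQ mulmx0 mul0mx.
by rewrite -QX -mulmxA QW mulmx0.
Qed.

End Splitting.

(** * Cyclic subspaces and companion matrices *)

Section Krylov.
Variable F : fieldType.

(** When d is the degree of a polynomial p with u * p(A) = 0, the rows span the
cyclic subspace F[A]u. *)
Definition krylov d k (A : 'M[F]_k) (u : 'rV_k) : 'M_(d, k) :=
  \matrix_(i < d) (u *m A ^+ i).

Lemma mul_krylov d k (A : 'M[F]_k.+1) (u : 'rV_k.+1) (v : 'rV_d) :
  v *m krylov d A u = u *m horner_mx A (rVpoly v).
Proof.
rewrite horner_rVpoly ![v *m _]mulmx_sum_row raddf_sum mulmx_sumr /=.
by apply: eq_bigr => i _; rewrite linearZ /= -scalemxAr !rowK mxvecK.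
Qed.

(** A linear relation among the rows is a nonzero polynomial of degree less than d
in A killing u. It is coprime to the irreducible p, which also kills u, so by
Bezout u = 0. *)
Lemma krylov_free (p : {poly F}) d k (A : 'M[F]_k.+1) (u : 'rV_k.+1) :
    irreducible_poly p -> (d < size p)%N -> u != 0 ->
  u *m horner_mx A p = 0 -> row_free (krylov d A u).
Proof.
move=> p_irr dp u0 up; apply: inj_row_free => v; rewrite mul_krylov => uv.
apply: (can_inj rVpolyK); rewrite raddf0; apply/eqP; apply: contraNT u0 => q0.
have : coprimep p (rVpoly v).
  rewrite irreducible_poly_coprime //; apply/negP => /(dvdp_leq q0).
  by apply/negP; rewrite -ltnNge (leq_ltn_trans (size_poly _ _)).
move=> /Bezout_eq1_coprimepP[[a b] /= ab1].
rewrite -[u]mulmx1 -[1%:M]/(1 : 'M_k.+1) -(rmorph1 (horner_mx A)) -ab1.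
rewrite ![_ * p]mulrC ![_ * rVpoly v]mulrC rmorphD !rmorphM mulmxDr /=.
by rewrite ![_ *m (_ * _)]mulmxA up uv !mul0mx addr0.
Qed.

(** The size is an independent parameter, so that it can be a literal successor;
it is meant to be the degree of p. *)
Definition companion (p : {poly F}) d : 'M[F]_d :=
  \matrix_(i, j) (if i.+1 == d then - p`_j else (i.+1 == j)%:R).

Lemma companion_root (p : {poly F}) d :
  p \is monic -> size p = d.+2 -> horner_mx (companion p d.+1) p = 0.
Proof.
move=> p_mon sp; suff e : char_poly (companion p d.+1) = p.
  by rewrite -[X in horner_mx _ X]e Cayley_Hamilton.
rewrite -[RHS](companionmxK p_mon) /companionmx.
have e : (size p).-1 = d.+1 by rewrite sp.
by case: _ / (esym e).
Qed.

(** Multiplying by A shifts the rows; the last one becomes u * A^d, rewritten by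
means of u * p(A) = 0. *)
Lemma krylov_companion (p : {poly F}) d k (A : 'M[F]_k.+1) (u : 'rV_k.+1) :
    p \is monic -> size p = d.+1 -> u *m horner_mx A p = 0 ->
  krylov d A u *m A = companion p d *m krylov d A u.
Proof.
move=> p_mon sp up; apply/row_matrixP => i.
rewrite !row_mul rowK -mulmxA -expmxSr [row i _ *m _]mulmx_sum_row.
have [iE|iN] := eqVneq i.+1 d.
  apply/eqP; rewrite -subr_eq0 -[X in _ == X]up -{2}[p]coefK poly_def sp.
  rewrite [horner_mx _ _]raddf_sum [u *m \sum_i _]mulmx_sumr.
  rewrite [X in _ == X]big_ord_recr /= [X in _ == X]addrC.
  rewrite -[p`_d]/(p`_d.+1.-1) -sp -/(lead_coef p) (monicP p_mon) scale1r.
  rewrite rmorphXn /= horner_mx_X iE -sumrN; apply/eqP; congr (_ + _).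
  apply: eq_bigr => j _; rewrite rowK !mxE iE eqxx scaleNr opprK linearZ /=.
  by rewrite rmorphXn /= horner_mx_X -scalemxAr.
have id : (i.+1 < d)%N by rewrite ltn_neqAle iN /=.
rewrite (bigD1 (Ordinal id)) //= big1 => [|j jN].
  by rewrite !mxE (negPf iN) eqxx scale1r rowK addr0.
rewrite !mxE (negPf iN) eq_sym.
by have /negPf -> : (j != i.+1 :> nat); rewrite ?scale0r.
Qed.

End Krylov.

(** * The generators of the group *)

Lemma NpotentK n (R : pzRingType) (e : npotent n R)
  (h : npmx e ^+ n == npmx e) : Npotent h = e.
Proof. by case: e h => -[k A] hA h; apply: val_inj. Qed.

Section Blocks.
Variables (n : nat) (hn : (1 < n)%N) (F : fieldType).
Hypothesis F0 : [pchar F] =i pred0.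

Let n1F : n.-1%:R != 0 :> F.
Proof. by rewrite ((pcharf0P F).1 F0) -lt0n -ltnS prednK // ltnW. Qed.

(** Apply the factors to w one after the other: the vector just before it becomes
zero is the one wanted. *)
Lemma peel_factor (s : seq {poly F}) k (A : 'M[F]_k.+1) (w : 'rV_k.+1) :
    w != 0 -> w *m horner_mx A (\prod_(p <- s) p) = 0 ->
  exists2 p, p \in s & exists2 u : 'rV_k.+1, u != 0 & u *m horner_mx A p = 0.
Proof.
elim: s w => [|p s IH] w w0.
  by rewrite big_nil rmorph1 mulmx1 => wE; rewrite wE eqxx in w0.
rewrite big_cons rmorphM mulmxA.
have [wp|wp /IH[//|q qs uq]] := eqVneq (w *m horner_mx A p) 0.
  by exists p; [rewrite mem_head | exists w].
by exists q => //; rewrite inE qs orbT.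
Qed.

(** What the companion block b of p has to satisfy for the rest of the argument:
it embeds into any matrix having a nonzero vector killed by p, and its traces
only depend on polynomials modulo p (as far as the residues 0 and 1 are
concerned). *)
Record simple_block (p : {poly F}) (b : npotent n F) : Prop := SimpleBlock {
  block_size : (0 < npsize b)%N;
  block_unit : npmx b ^+ n.-1 = 1;
  block_embeds : forall k (A : 'M[F]_k.+1) (u : 'rV_k.+1),
    u != 0 -> u *m horner_mx A p = 0 ->
    exists2 U : 'M_(npsize b, k.+1), row_free U & U *m A = npmx b *m U;
  block_trace0 : forall q, p %| 'X * q -> nptrace q b = 0;
  block_trace1 : forall q, p %| 'X * q - 1 -> nptrace q b = (npsize b)%:R }.

Lemma exists_simple_block p :
    irreducible_poly p -> p \is monic -> p %| 'X^(n.-1) - 1 ->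
  exists b, simple_block p b.
Proof.
move=> p_irr p_mon pX; have [p_gt1 _] := p_irr.
have [d sp] : exists d, size p = d.+2 by case: size p_gt1 => [|[|d]] // _; exists d.
pose C := companion p d.+1.
have dvd_C q : p %| q -> horner_mx C q = 0.
  by move=> /dvdpP[r ->]; rewrite rmorphM /= (companion_root p_mon sp) mulr0.
have C1 : C ^+ n.-1 = 1.
  apply/eqP; rewrite -subr_eq0 -(dvd_C _ pX) rmorphB rmorph1 rmorphXn /=.
  by rewrite horner_mx_X.
have hC : C ^+ n == C.
  by rewrite -{1}(prednK (ltnW hn)) exprSr C1 mul1r.
exists (Npotent hC); split=> // [k A u u0 up | q pq | q pq].
- exists (krylov d.+1 A u); first by apply: krylov_free p_irr _ u0 up; rewrite sp.
  exact: krylov_companion.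
- by rewrite nptrace_horner dvd_C // raddf0.
- rewrite nptrace_horner -[RHS](mxtrace1 F d.+1); congr (\tr _).
  apply/eqP; rewrite -subr_eq0; apply/eqP; apply: etrans (dvd_C _ pq).
  by rewrite rmorphB [X in _ = _ - X]rmorph1.
Qed.

Variables (r : nat) (ps : r.-tuple {poly F}).
Hypothesis ps_prod : \prod_(p <- ps) p = 'X^(n.-1) - 1.
Variable b : 'I_r -> npotent n F.
Hypothesis b_simple : forall j, simple_block (tnth ps j) (b j).

(** Induction on the rank: a nonzero n-potent contains a copy of some block, which
splits off. *)
Lemma blocks_generate e :
  exists m : 'I_r -> nat, Vclass hn e = \sum_j Vclass hn (b j) *+ m j.
Proof.
have [t] := ubnP (\rank (npmx e)); elim: t e => // t IH e.
have [e0 _|e0] := eqVneq (npmx e) 0.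
  exists (fun=> 0%N); rewrite big1 => [|j _]; last by rewrite mulr0n.
  apply: Vclass_eq; apply/(npeqP hn); exists 0, 0.
  by rewrite mul0mx e0; split=> //; apply/matrixP => -[].
case: e e0 => -[k A] hA; rewrite /npmx /= => A0 lt_t.
case: k => [|k] in A hA A0 lt_t *.
  by case/eqP: A0; apply/matrixP => -[].
(* A vector of the form w * A is used because X^n - X has the additional factor
   X: on the image of A the product of the ps already vanishes. *)
have [w /eqP w0] : exists w : 'rV_k.+1, w *m A <> 0.
  apply: contrapT => wA; case/eqP: A0; apply/row_matrixP => i.
  by rewrite row0 rowE; apply: contrapT => wiA; apply: wA; exists (delta_mx 0 i).
have wA0 : w *m A *m horner_mx A (\prod_(p <- ps) p) = 0.
  rewrite ps_prod rmorphB rmorph1 rmorphXn /= horner_mx_X -mulmxA mulmxBr mulmx1.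
  by rewrite -expmxS prednK 1?ltnW // (eqP hA) subrr mulmx0.
have [p ps_p [u u0 up]] := peel_factor w0 wA0.
have [j pE] := elimT (tnthP _ _) ps_p; rewrite {}pE in up.
have [d_gt0 C1 emb _ _] := b_simple j.
have [U Ufree UA] := emb _ _ _ u0 up.
have hC : npmx (b j) ^+ n == npmx (b j) by rewrite npmxX.
have [f [ef lt_f]] := npotent_split hn n1F hA hC d_gt0 C1 Ufree UA.
have [m fE] := IH f (leq_trans lt_f lt_t).
exists (fun i => (i == j) + m i)%N.
under eq_bigr do rewrite mulrnDr.
rewrite big_split -fE /= (bigD1 j) //= eqxx mulr1n big1 ?addr0.
  by rewrite (Vclass_eq hn ef) Vclass_diag NpotentK.
by move=> i /negPf ->; rewrite mulr0n.
Qed.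

End Blocks.

(** * The group is free on the irreducible factors *)

Section Basis.
Variables (n : nat) (hn : (1 < n)%N) (F : fieldType).
Hypothesis F0 : [pchar F] =i pred0.
Variables (r : nat) (ps : r.-tuple {poly F}).
Hypothesis ps_prod : \prod_(p <- ps) p = 'X^(n.-1) - 1.

(** The factor 'X ensures that q yields an invariant trace. As X^(n-1) - 1 is
separable and prime to X, each factor is prime to X times the product of the
others, and q comes from a Bezout relation. *)
Lemma dual_poly i : exists q : {poly F}, forall j,
  if j == i then tnth ps j %| 'X * q - 1 else tnth ps j %| 'X * q.
Proof.
have n1 : (n.-1 == 0)%N = false by case: (n) hn => [|[]].
pose P := \prod_(j | j != i) tnth ps j.
have pP : tnth ps i * P = 'X^(n.-1) - 1.
  by rewrite -ps_prod big_tuple [RHS](bigD1 i).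
have co_P : coprimep (tnth ps i) P.
  have := @separable_Xn_sub_1 F n.-1; rewrite -pP separable_mul.
  by rewrite ((pcharf0P F).1 F0) n1 => /(_ isT)/and3P[].
have co_X : coprimep (tnth ps i) 'X.
  apply: (@coprimep_dvdr _ ('X^(n.-1) - 1)); first by rewrite -pP dvdp_mulr.
  rewrite coprimepX rootE.
  by rewrite !hornerE expr0n n1 sub0r oppr_eq0 oner_eq0.
have /Bezout_eq1_coprimepP[[a c] /= ac] : coprimep (tnth ps i) ('X * P).
  by rewrite coprimepMr co_X.
exists (c * P) => j; rewrite mulrCA; have [->|ji] := eqVneq.
  by rewrite -ac opprD addrCA subrr addr0 -mulNr dvdp_mull.
by rewrite !dvdp_mull // /P (bigD1 j) //= dvdp_mulr.
Qed.

(** The i-th coordinate of a relation between the generators is detected, up to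
the size of the block, by the trace attached to the i-th dual polynomial. *)
Theorem K0_free :
    {in ps, forall p, irreducible_poly p} -> {in ps, forall p, p \is monic} ->
  zmod_iso (K0 n hn F) 'rV[int]_r.
Proof.
move=> ps_irr ps_mon.
have /choice[b b_simple] j : exists b, simple_block (n := n) (tnth ps j) b.
  apply: exists_simple_block => //; [exact/ps_irr/mem_tnth|exact/ps_mon/mem_tnth|].
  by rewrite -ps_prod big_tuple (bigD1 j) //= dvdp_mulr.
pose cl j := K0class (Vclass hn (b j)).
pose phi (v : 'rV[int]_r) := \sum_j cl j *~ v 0 j.
have phiB : {morph phi : v w / v - w}.
  by move=> v w; rewrite /phi -sumrB; apply: eq_bigr => j _; rewrite !mxE mulrzBr.
pose hB := GRing.isZmodMorphism.Build _ _ phi phiB.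
pose Phi : {additive 'rV[int]_r -> K0 n hn F} := HB.pack phi hB.
have phi_inj : injective phi.
  apply: (raddf_inj (f := Phi)) => v /= v0; apply/rowP => i; rewrite mxE.
  have [q dual_q] := dual_poly i.
  have /eqP := congr1 (K0trace hn q) v0.
  rewrite raddf_sum raddf0 (bigD1 i) //= big1 => [|j ji].
    have := dual_q i; rewrite eqxx => /(block_trace1 (b_simple i)) tr_i.
    rewrite addr0 raddfMz K0traceE tr_i; have := block_size (b_simple i).
    case: (npsize _) (v 0 i) => [//|d] [] m _.
      by rewrite -pmulrn -mulrnA ((pcharf0P F).1 F0) muln_eq0 /= => /eqP ->.
    by rewrite NegzE mulrNz oppr_eq0 -pmulrn -mulrnA ((pcharf0P F).1 F0).
  have := dual_q j; rewrite (negPf ji) => /(block_trace0 (b_simple j)) tr_j.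
  by rewrite raddfMz K0traceE tr_j mul0rz.
have phi_surj u : exists v, phi v = u.
  have [x [y ->]] := K0class_diff u.
  have [e ->] := Vclass_surj x; have [f ->] := Vclass_surj y.
  have [m ->] := blocks_generate hn F0 ps_prod b_simple e.
  have [l ->] := blocks_generate hn F0 ps_prod b_simple f.
  exists (\row_j ((m j)%:Z - (l j)%:Z)).
  rewrite !raddf_sum -big_split; apply: eq_bigr => j _ /=.
  by rewrite mxE mulrzBr !raddfMn.
apply: zmod_iso_sym; exists Phi.
have [psi psiK] := choice phi_surj.
by exists psi => // v; apply: phi_inj; rewrite psiK.
Qed.

End Basis.

(** * Free abelian groups of finite rank *)

Lemma row_mx_of_additive a b (f : {additive 'rV[int]_a -> 'rV[int]_b}) :
  exists M : 'M[int]_(a, b), forall v, f v = v *m M.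
Proof.
exists (\matrix_(i < a) f (delta_mx 0 i)) => v.
rewrite {1}[v]row_sum_delta raddf_sum mulmx_sum_row; apply: eq_bigr => i _.
by rewrite rowK -[v 0 i]intz !scaler_int raddfMz.
Qed.

(** An isomorphism and its inverse are integer matrices M and N with M * N = 1;
over the rationals the rank of M * N is at most the number of columns of M. *)
Lemma rV_int_iso_dim a b : zmod_iso 'rV[int]_a 'rV[int]_b -> (a <= b)%N.
Proof.
move=> [f [g fK gK]].
have [h hE] := additive_inverse fK gK.
have [M fM] := row_mx_of_additive f; have [N hN] := row_mx_of_additive h.
have MN : M *m N = 1%:M.
  by apply/row_matrixP => i; rewrite !rowE mulmxA -fM mulmx1 -hN hE fK.
have <- : \rank (map_mx (intr : int -> rat) (M *m N)) = a.
  by rewrite MN map_mx1 mxrank1.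
by rewrite map_mxM (leq_trans (mxrankM_maxl _ _)) ?rank_leq_col.
Qed.

Lemma rV1_iso (G : zmodType) : zmod_iso 'rV[G]_1 G.
Proof.
pose f (v : 'rV[G]_1) := v 0 0.
have fB : {morph f : x y / x - y} by move=> x y; rewrite /f !mxE.
pose hB := GRing.isZmodMorphism.Build _ _ f fB.
exists (HB.pack f hB : {additive 'rV[G]_1 -> G}).
exists (fun x => const_mx x) => [v|x]; last by rewrite /= /f mxE.
by apply/rowP => i; rewrite ord1 mxE.
Qed.

Lemma rV2_iso_twoZ : zmod_iso 'rV[int]_2 (int * twoZ)%type.
Proof.
have ev (x : int) : x * 2 \in dvdz 2 by apply: dvdz_mull.
pose f (v : 'rV[int]_2) : int * twoZ := (v 0 0, Sub (v 0 1 * 2) (ev (v 0 1))).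
have fB : {morph f : x y / x - y}.
  move=> x y; congr (_, _); first by rewrite !mxE.
  by apply: val_inj; rewrite raddfB !SubK !mxE mulrBl.
pose hB := GRing.isZmodMorphism.Build _ _ f fB.
exists (HB.pack f hB : {additive 'rV[int]_2 -> (int * twoZ)%type}).
exists (fun x => \row_j if j == 0 then x.1 else (val x.2 %/ 2)%Z).
  move=> v; apply/rowP => j; rewrite mxE SubK mulzK //.
  by case: j => -[|[|//]] lj /=; congr (v _ _); apply: val_inj.
move=> [x y]; congr (_, _); first by rewrite mxE.
by apply: val_inj; rewrite SubK mxE /= divzK // (valP y).
Qed.

(** * Cyclotomic fields *)

Section LinearFactors.
Variable F : fieldType.
Hypothesis F0 : [pchar F] =i pred0.

(** The irreducible factors of X^m - 1 are then linear, one for each power of z. *)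
Corollary K0_prim_root m (hm : (1 < m.+1)%N) (z : F) :
  m.-primitive_root z -> zmod_iso (K0 m.+1 hm F) 'rV[int]_m.
Proof.
move=> z_prim; pose ps := [tuple 'X - (z ^+ i)%:P | i < m].
apply: (@K0_free _ _ _ F0 _ ps) => [|p|p].
- rewrite -(factor_Xn_sub_1 z_prim) big_tuple big_mkord.
  by apply: eq_bigr => i _; rewrite tnth_mktuple.
- by move=> /mapP[i _ ->]; apply: irredp_XsubC.
- by move=> /mapP[i _ ->]; apply: monicXsubC.
Qed.

End LinearFactors.

Section CyclotomicField.
Variables (m : nat) (z : algC).
Hypothesis z_prim : m.-primitive_root z.
Local Notation K := (cyclotomic_field m z).

Lemma cyclotomic_pchar0 : [pchar K] =i pred0.
Proof.
by move=> p; rewrite -(fmorph_pchar (@subfx_inj _ _ ratr z ('X^m - 1))) pchar_num.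
Qed.

Let z_root : root (map_poly ratr ('X^m - 1)) z.
Proof.
rewrite rmorphB rmorph1 /= map_polyXn rootE !hornerE.
by rewrite (prim_expr_order z_prim) subrr.
Qed.

Let Xm1_neq0 : 'X^m - 1 != 0 :> {poly rat}.
Proof. by rewrite monic_neq0 // monicXnsubC ?(prim_order_gt0 z_prim). Qed.

Lemma cyclotomic_prim_root : exists x : K, m.-primitive_root x.
Proof.
have zE : subfx_inj (subfx_root ratr z ('X^m - 1)) = z by apply: subfx_inj_root.
exists (subfx_root ratr z _); move: z_prim; rewrite -{1}zE.
by rewrite fmorph_primitive_root.
Qed.

Lemma cyclotomic_eval (x : K) :
  exists q : {poly rat}, subfx_inj x = (map_poly ratr q).[z].
Proof. by have [q ->] := subfxE x; exists q; apply: subfx_inj_eval. Qed.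

End CyclotomicField.

(** Compare the parities of the exponents of 3 in the squares of the numerator and
of the denominator. *)
Lemma rat_sqr_neq3 (c : rat) : c ^+ 2 != 3.
Proof.
apply/eqP => c3.
have : numq c ^+ 2 = 3 * denq c ^+ 2.
  apply: (@intr_inj rat); rewrite !expr2 !intrM numqE.
  by rewrite -[3%:~R]/(3 : rat) -c3; ring.
move=> /(congr1 absz); rewrite abszM !abszX => /(congr1 (logn 3)) /(congr1 odd).
rewrite lognM ?expn_gt0 ?absz_gt0 ?denq_neq0 // !lognX oddD !oddM.
by have -> : logn 3 `|3| = 1%N by [].
Qed.

Lemma gaussian_coords (q : {poly rat}) : exists a b : rat,
  (map_poly ratr q).['i] = ratr a + 'i * ratr b :> algC.
Proof.
elim/poly_ind: q => [|q c [a [b IH]]].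
  by exists 0, 0; rewrite rmorph0 horner0 raddf0 mulr0 addr0.
exists (c - b), a; rewrite rmorphD rmorphM /= map_polyX map_polyC hornerMXaddC IH.
have i2 := sqrCi algC; rewrite raddfB /=.
by move: ('i) i2 => j i2; ring: i2.
Qed.

(** Write x = a + ib with a and b rational. The imaginary part of x^2 + x + 1 is
b(2a + 1). If b = 0, the real part a^2 + a + 1 is positive; if a = -1/2, it is
3/4 - b^2, so that (2b)^2 = 3. *)
Lemma Q4_no_cube_root (x : Q4) : x ^+ 2 + x + 1 != 0.
Proof.
apply/eqP => /(congr1 subfx_inj); rewrite rmorph0 !rmorphD rmorph1 rmorphXn /=.
have [q ->] := cyclotomic_eval primitive_i x; have [a [b ->]] := gaussian_coords q.
have i2 := sqrCi algC.
have -> : (ratr a + 'i * ratr b) ^+ 2 + (ratr a + 'i * ratr b) + 1 =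
    ratr (a ^+ 2 - b ^+ 2 + a + 1) + 'i * ratr (b * (a * 2 + 1)) :> algC.
  by rewrite !rmorphE /=; ring: i2.
move=> e; have real_ratr (c : rat) : (ratr c : algC) \is Num.real.
  exact: rpred_rat.
have := congr1 (@Re _) e; have := congr1 (@Im _) e.
rewrite Re_rect // Im_rect // raddf0.
rewrite (raddf0 (@Re algC)) => /eqP; rewrite fmorph_eq0 mulf_eq0 => b0.
move=> /eqP; rewrite fmorph_eq0 => /eqP re0.
case/orP: b0 {e i2} => /eqP h; first by rewrite h in re0; nra.
have aE : a = - 1 / 2 by lra.
by have /eqP[] := rat_sqr_neq3 (b * 2); rewrite aE in re0; nra.
Qed.

Lemma quadratic_irreducible : irreducible_poly ('X^2 + 'X + 1 : {poly Q4}).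
Proof.
have sz : size ('X^2 + 'X + 1 : {poly Q4}) = 3%N.
  by rewrite -addrA size_polyDl size_polyXn // -[1]/(1%:P) size_XaddC.
apply: cubic_irreducible => [|x]; first by rewrite sz.
by rewrite rootE !hornerE Q4_no_cube_root.
Qed.

Lemma quadratic_monic (R : nzRingType) : 'X^2 + 'X + 1 \is @monic R.
Proof.
rewrite monicE -addrA lead_coefDl ?lead_coefXn // -[1]/(1%:P).
by rewrite size_XaddC size_polyXn.
Qed.

Lemma Q4_pchar0 : [pchar Q4] =i pred0.
Proof. exact: cyclotomic_pchar0. Qed.

(** Although Q(i) does not contain the cube roots of unity, its group has rank two
because the quadratic factor still contributes one generator. *)
Lemma K0_4_Q4 : zmod_iso (K0 4 isT Q4) 'rV[int]_2.
Proof.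
apply: (@K0_free _ _ _ Q4_pchar0 _ [tuple 'X - 1%:P; 'X^2 + 'X + 1]).
- by rewrite /= big_cons big_seq1; ring.
- move=> p; rewrite !inE => /orP[]/eqP ->; first exact: irredp_XsubC.
  exact: quadratic_irreducible.
- move=> p; rewrite !inE => /orP[]/eqP ->; first exact: monicXsubC.
  exact: quadratic_monic.
Qed.

(** * The groups of Q(4) and Q(3) *)

Theorem theorem3p15 :
  [/\ zmod_iso (K0 2 isT Q4) int,
      zmod_iso (K0 3 isT Q4) 'rV[int]_2,
      zmod_iso (K0 4 isT Q4) (int * twoZ)%type &
      zmod_iso (K0 5 isT Q4) 'rV[int]_4]
  /\ (~ zmod_iso (K0 4 isT Q4) 'rV[int]_3
      /\ zmod_iso 'rV[int]_3 (K0 4 isT Q3)).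
Proof.
have [j j_prim] := cyclotomic_prim_root primitive_i.
have [w w_prim] := cyclotomic_prim_root primitive_omega3.
split; last split.
- split.
  + apply: zmod_iso_trans (rV1_iso _).
    (* Powers of j give the primitive roots of unity of orders 1 and 2. *)
    exact: (@K0_prim_root _ Q4_pchar0 1 isT _ (exp_prim_root j_prim 4)).
  + exact: (@K0_prim_root _ Q4_pchar0 2 isT _ (exp_prim_root j_prim 2)).
  + exact: zmod_iso_trans K0_4_Q4 rV2_iso_twoZ.
  + exact: (@K0_prim_root _ Q4_pchar0 4 isT _ j_prim).
- move=> iso3; have := zmod_iso_trans (zmod_iso_sym iso3) K0_4_Q4.
  by move/rV_int_iso_dim.
- apply: zmod_iso_sym.
  exact: (@K0_prim_root _ (@cyclotomic_pchar0 _ _) 3 isT _ w_prim).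
Qed.
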